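(* Let $U:\mathcal X\times\mathcal X\to\mathbb R$ be a positive kernel with $\mathrm{Osc}_2U\le4$. Then for all $N\ge1$, $\delta\in(0,1)$, $m\in\mathcal P(\mathcal X)$ and $\nu^N\in\mathcal P(\mathcal X^N)$, $$N\,\mathbb E_{\boldsymbol X\sim\nu^N}\bigl[\langle U,(\mu_{\boldsymbol X}-m)^{\otimes2}\rangle\bigr]\le\frac{2}{1-\delta}H(\nu^N|m^{\otimes N})+4\Bigl(1+\frac{1-\delta}{2\delta}\Bigr).$$
   Context: $\mathcal X$ is either $\mathbb T^d$ (torus) or $\mathbb R^d$; $\mathcal P$ denotes Borel probability measures and $\mathcal P_2$ those with finite second moment. $\langle\cdot,\cdot\rangle$ is integration of a function against a (signed) measure. Kernels are measurable and of quadratic growth: $|U(x,y)|\le C(1+|x|^2+|y|^2)$ (void on the torus). $U$ is positive if $\langle U,(\nu-\nu')^{\otimes2}\rangle\ge0$ for all $\nu,\nu'\in\mathcal P_2(\mathcal X)$. $\mathrm{Osc}_2U=\sup_{x,y,z,w\in\mathcal X}\langle U,(\delta_x-\delta_y)\otimes(\delta_z-\delta_w)\rangle$. For $\boldsymbol x=(x^1,\dots,x^N)\in\mathcal X^N$, $\mu_{\boldsymbol x}=\frac1N\sum_{i=1}^N\delta_{x^i}$. $H(\nu|m)=\int\log\frac{d\nu}{dm}\,d\nu$ ($+\infty$ if $\nu\not\ll m$). When $m$ has no second moment, $\langle U,(\mu-m)^{\otimes2}\rangle$ is understood by replacing $U$ with the bounded kernel $U(x,y)-U(x,o)-U(o,y)+U(o,o)$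 ($o\in\mathcal X$ fixed), which gives the same pairing with products of mass-zero measures. *)

(* Defs.v *)
From HB Require Import structures.
From mathcomp Require Import all_boot all_order all_algebra.
From mathcomp Require Import generic_quotient.
From mathcomp Require Import all_classical all_reals all_analysis.
Import Order.TTheory GRing.Theory Num.Theory.
Import numFieldNormedType.Exports.

Set Implicit Arguments.
Unset Strict Implicit.
Unset Printing Implicit Defensive.

Local Open Scope classical_set_scope.
Local Open Scope quotient_scope.
Local Open Scope ring_scope.

Section circle.
Variable R : realType.

Definition eq_mod1 (x y : R) : bool := (x - y) \is a Num.int.

Lemma eq_mod1_refl : reflexive eq_mod1.
Proof. by move=> x; rewrite /eq_mod1 subrr rpred0. Qed.

Lemma eq_mod1_sym : symmetric eq_mod1.
Proof. by move=> x y; rewrite /eq_mod1 -opprB rpredN. Qed.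

Lemma eq_mod1_trans : transitive eq_mod1.
Proof.
move=> y x z xy yz; rewrite /eq_mod1 -(subrK y x) -addrA.
exact: rpredD.
Qed.

Canonical eq_mod1_equiv := EquivRel eq_mod1 eq_mod1_refl eq_mod1_sym eq_mod1_trans.

Definition RmodZ := quotient_topology {eq_quot eq_mod1_equiv}.
HB.instance Definition _ := Topological.on RmodZ.
HB.instance Definition _ := Pointed.on RmodZ.

(* The Borel sigma-algebra of the quotient topology of R / Z. *)
Definition circle := g_sigma_algebraType (@open RmodZ).
HB.instance Definition _ := Measurable.on circle.

End circle.

Variant space_kind := Torus | Euclidean.

Section space.
Variable R : realType.

Definition coord_display (k : space_kind) : measure_display :=
  match k with
  | Torus => sigma_display (@open (RmodZ R))
  | Euclidean => sigma_display (R.-ocitv.-measurable)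
  end.

Definition coord (k : space_kind) : measurableType (coord_display k) :=
  match k with
  | Torus => circle R
  | Euclidean => measurableTypeR R
  end.

(* The torus (R/Z)^d, resp. R^d. Coordinates are second countable, so that the
   product sigma-algebra carried by tuples is the Borel one. *)
Definition base_space (k : space_kind) (d : nat) :
    measurableType (measure_tuple_display (coord_display k)) :=
  (d.-tuple (coord k))%type.

Definition sqnorm (d : nat) (x : base_space Euclidean d) : R :=
  \sum_(i < d) (tnth x i : R) ^+ 2.

(* Torus: all probability measures have finite second moment, and the growth
   condition is void. *)
Definition finite_second_moment (k : space_kind) (d : nat) :
    probability (base_space k d) R -> Prop :=
  match k with
  | Torus => fun _ => True
  | Euclidean => fun nu => (\int[nu]_x (sqnorm x)%:E < +oo)%E
  end.

Definition quadratic_growth (k : space_kind) (d : nat) :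
    (base_space k d * base_space k d -> R) -> Prop :=
  match k with
  | Torus => fun _ => True
  | Euclidean => fun U => exists C : R, forall x y : base_space Euclidean d,
      `|U (x, y)| <= C * (1 + sqnorm x + sqnorm y)
  end.

End space.

Section pairing.
Context (disp : measure_display) (T : measurableType disp) (R : realType).
Implicit Types (U : T * T -> R) (nu eta : {finite_measure set T -> \bar R}).

(* <U, (nu - nu') (x) (eta - eta')>: the product of signed measures is expanded
   by bilinearity. *)
Definition pair_diff U nu nu' eta eta' : R :=
  \int[(nu \x eta)%E]_p U p - \int[(nu \x eta')%E]_p U p
  - \int[(nu' \x eta)%E]_p U p + \int[(nu' \x eta')%E]_p U p.

Definition osc2 U : \bar R :=
  ereal_sup [set r | exists x y z w : T,
    r = (pair_diff U \d_x \d_y \d_z \d_w)%:E].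

Definition recenter (o : T) U : T * T -> R :=
  fun p => U p - U (p.1, o) - U (o, p.2) + U (o, o).

End pairing.

Section empirical.
Context (disp : measure_display) (T : measurableType disp) (R : realType).
Context (N : nat) (x : N.-tuple T).

Definition empirical (A : set T) : \bar R :=
  ((N%:R^-1)%:E * \sum_(i < N) \d_(tnth x i) A)%E.

Let empiricalE : empirical =
  mscale (N%:R^-1)%:nng (msum (fun i => \d_(nth point x i)) N).
Proof.
apply/funext => A; rewrite /empirical /mscale /msum/=; congr (_ * _)%E.
by apply: eq_bigr => i _; rewrite (tnth_nth point).
Qed.

Let empirical0 : empirical set0 = 0%E.
Proof. by rewrite empiricalE measure0. Qed.

Let empirical_ge0 A : (0 <= empirical A)%E.
Proof. by rewrite empiricalE measure_ge0. Qed.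

Let empirical_sigma_additive : semi_sigma_additive empirical.
Proof. by rewrite empiricalE; exact: measure_semi_sigma_additive. Qed.

HB.instance Definition _ := isMeasure.Build _ _ _ empirical
  empirical0 empirical_ge0 empirical_sigma_additive.

Let empirical_fin : fin_num_fun empirical.
Proof.
move=> A mA; rewrite /empirical fin_numM//; apply/sum_fin_numP => i _ _.
exact: fin_num_measure.
Qed.

HB.instance Definition _ := @Measure_isFinite.Build _ _ _ empirical empirical_fin.

End empirical.

Section product_power.
Context (disp : measure_display) (T : measurableType disp) (R : realType).

Definition cons_pair (n : nat) (p : T * n.-tuple T) : n.+1.-tuple T :=
  [tuple of p.1 :: p.2].

Let measurable_cons_pair n : measurable_fun setT (@cons_pair n).
Proof. exact: measurable_cons. Qed.

HB.instance Definition _ n :=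
  isMeasurableFun.Build _ _ _ _ (@cons_pair n) (@measurable_cons_pair n).

Fixpoint prod_power (m : probability T R) (n : nat) :
    probability (n.-tuple T) R :=
  match n with
  | 0 => \d_([tuple] : 0.-tuple T)
  | n'.+1 => distribution (m \x prod_power m n')%E (@cons_pair n')
  end.

Lemma prod_powerE (m : probability T R) (n : nat) (A : 'I_n -> set T) :
  (forall i, measurable (A i)) ->
  prod_power m n [set x | forall i, A i (tnth x i)] = (\prod_(i < n) m (A i))%E.
Proof.
elim: n A => [|n IHn] A mA.
  by rewrite big_ord0/= diracE mem_set// => -[].
rewrite big_ord_recl -IHn; last by move=> i; exact: mA.
rewrite /= /distribution /pushforward.
rewrite (_ : _ @^-1` _ =
    A ord0 `*` [set x | forall i, A (lift ord0 i) (tnth x i)]); last first.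
  apply/seteqP; split => [[a x] /= h|[a x] /= [h0 h] i].
    split; first exact: (h ord0).
    by move=> i; have := h (lift ord0 i); rewrite tnthS.
  by case: (unliftP ord0 i) => [j|] ->; rewrite ?tnthS.
rewrite product_measure1E//.
rewrite (_ : [set x | _] =
    \bigcap_i ((fun x => tnth x i) @^-1` A (lift ord0 i))); last first.
  by apply/seteqP; split => x /= h i; [move=> _|]; exact: h.
apply: fin_bigcap_measurable => [|i _]; first exact: finite_finset.
 rewrite -[X in measurable X]setTI.
exact: measurable_tnth.
Qed.

End product_power.

Section entropy.
Context (disp : measure_display) (T : measurableType disp) (R : realType).
Local Open Scope charge_scope.

Definition rel_entropy (nu m : probability T R) : \bar R :=
  if `[< nu `<< m >] then
    (\int[nu]_x lne (('d (charge_of_finite_measure nu) '/d m) x))%E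
  else +oo%E.

End entropy.

Section kernels.
Context (R : realType) (k : space_kind) (d : nat).
Local Notation X := (base_space R k d).
Implicit Type U : X * X -> R.

(* The integrability clause only says that the brackets are well defined. It is
   automatic in the Euclidean case under [quadratic_growth]. *)
Definition positive_kernel U : Prop :=
  forall nu nu' : probability X R,
    finite_second_moment nu -> finite_second_moment nu' ->
    (nu \x nu')%E.-integrable setT (EFin \o U) /\ 0 <= pair_diff U nu nu' nu nu'.

(* <U, (mu - m)^{(x)2}>, with the bounded recentered kernel when m has no
   second moment. *)
Definition sq_pairing (o : X) U (mu : {finite_measure set X -> \bar R})
    (m : probability X R) : R :=
  if `[< finite_second_moment m >] then pair_diff U mu m mu m
  else pair_diff (recenter o U) mu m mu m.

End kernels.

(* Main.v *)
From HB Require Import structures.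
Require Import Defs.
From mathcomp Require Import all_boot all_order all_algebra.
From mathcomp Require Import all_classical all_reals all_analysis.
From mathcomp Require Import measurable_realfun.
From mathcomp Require Import ring lra.
Import Order.TTheory GRing.Theory Num.Theory.
Import numFieldNormedType.Exports.

Local Open Scope classical_set_scope.
Local Open Scope ring_scope.

Set Implicit Arguments.
Unset Strict Implicit.
Unset Printing Implicit Defensive.

(* Let V be U centred by m in both variables and symmetrised, so that
   N <U, (mu_x - m)^2> = N^-1 sum_(i, j) V(x_i, x_j).  By the entropy duality of
   Donsker and Varadhan it is enough to show that, under m^N,
     E exp ((1 - delta) / (2 N) * sum_(i, j) V(x_i, x_j)) <= exp (1/delta - delta).
   Think of V(x, y) as <phi x, phi y> with phi centred.  For a partial sum s of
   the phi x_i, the variable <s, phi x> has mean 0 and oscillation at most 2 |s|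
   (Cauchy-Schwarz and Osc_2 U <= 4), and |phi x|^2 <= 4, so Hoeffding's lemma
   gives, for t > 1,
     E exp (|s + phi x|^2 / (2 t)) <= exp (|s|^2 / (2 (t - 1)) + 2 / t).
   Iterating N times from t = N / (1 - delta) costs
   sum_(k < N) 2 / (t - k) <= 1/delta - delta. *)

(** * Elementary real inequalities *)

Lemma archimedean_le0 {R : archiRealFieldType} (e c : R) :
  (forall n : nat, n%:R * e <= c) -> e <= 0.
Proof.
move=> ec; rewrite leNgt; apply/negP => e0.
have := ec (Num.truncn (c / e)).+1; apply/negP; rewrite -ltNge.
by rewrite -ltr_pdivrMr// truncnS_gt.
Qed.

(** Comparison with an integral bounds the sum by 2 ln r with r = t / (t - n), and 2 ln r <= r -
    1/r. The rational form allows a direct induction; for t = n / (1 - delta) the ratio r is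
    1/delta. *)
Lemma sum_inv_le {R : realFieldType} (t : R) (n : nat) : n%:R < t ->
  \sum_(k < n) 2 / (t - k%:R) <= t / (t - n%:R) - (t - n%:R) / t.
Proof.
elim: n => [|n IHn] nt; first by rewrite big_ord0 subr0 subrr.
have nt' : n%:R + 1 < t by move: nt; rewrite -natr1.
have n0 : 0 <= n%:R :> R := ler0n _ _.
rewrite big_ord_recr/= -[n.+1%:R]natr1; apply: le_trans (lerD (IHn _) (lexx _)) _; first lra.
set u := t - n%:R; have -> : t - (n%:R + 1) = u - 1 by rewrite /u; ring.
have u1 : 1 < u by rewrite /u; lra.
have t0 : 0 < t by lra.
rewrite -subr_ge0.
(* Increment of the bound minus the new summand, written as a visibly nonnegative fraction. *)
have -> : t / (u - 1) - (u - 1) / t - (t / u - u / t + 2 / u) =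
    ((t - (u - 1)) ^+ 2 + (u - 1)) / (t * u * (u - 1)).
  by field; rewrite !gt_eqF//; lra.
have u0 : 0 < u - 1 by lra.
have d0 : 0 <= t * u * (u - 1) by rewrite !mulr_ge0 ?(ltW t0) ?(ltW u0)//; lra.
by rewrite divr_ge0// addr_ge0 ?sqr_ge0 ?ltW.
Qed.

(** * Hoeffding's lemma *)

Section two_point.
Context {R : realType}.
Implicit Types q h : R.

(** Laplace transform at [h] of a Bernoulli variable of parameter [q]. *)
Let w q h : R := 1 - q + q * expR (- h).

Let w_gt0 q h : 0 <= q <= 1 -> 0 < w q h.
Proof.
move=> /andP[q0 q1]; have e0 := expR_gt0 (- h); rewrite /w.
have [->|qn0] := eqVneq q 0; first by lra.
have : 0 < q by lra.
by move=> q0'; have := mulr_gt0 q0' e0; lra.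
Qed.

Let is_derive_w q h : is_derive h 1 (w q) (- (q * expR (- h))).
Proof. by rewrite /w; apply: is_derive_eq; rewrite /GRing.scale/=; ring. Qed.

Let is_derive_slope q h : 0 <= q <= 1 ->
  is_derive h 1 (fun h : R => h / 4 - q + q * expR (- h) / w q h)
   (4^-1 - (q * expR (- h) / w q h) * (1 - q * expR (- h) / w q h)).
Proof.
move=> q01; have w0 : w q h != 0 by rewrite gt_eqF// w_gt0.
have dw := is_derive_w q h.
have dV : is_derive h 1 (fun h => (w q h)^-1)
  (- (w q h) ^- 2 *: - (q * expR (- h))).
  exact: is_deriveV.
apply: is_derive_eq; rewrite /GRing.scale/=.
by move: (expR _) (w q h) w0 {dw dV} => e W W0; field.
Qed.

(** The slope, which is the derivative of h^2/8 - q h - ln (w q h), vanishes at 0. Its own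
    derivative is 1/4 minus the variance of a tilted Bernoulli variable, and such a variance is at
    most 1/4. *)
Let slope_ge0 q h : 0 <= q <= 1 -> 0 <= h ->
  0 <= h / 4 - q + q * expR (- h) / w q h.
Proof.
move=> q01 h0.
pose f h : R := h / 4 - q + q * expR (- h) / w q h.
have -> : 0 = f 0 by rewrite /f /w oppr0 expR0 !mulr1; field; lra.
apply: (@ger0_derive1_ndecry R f 0 _ _ _ _ _ (lexx 0) h0).
- by move=> x _; have [] := is_derive_slope x q01.
- move=> x _; have [_ df] := is_derive_slope x q01.
  rewrite derive1E df; set t := _ / _.
  by have := sqr_ge0 (t - 2^-1); nra.
- apply: derivable_within_continuous => x _.
  by have [] := is_derive_slope x q01.
Qed.

(** Hoeffding's lemma for a centred law on two points at distance [h]. The logarithm of the left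
    side is q h + ln (w q h), so it is enough that [f] below is 0 at 0 and nondecreasing. *)
Lemma two_point_expR q h : 0 <= q <= 1 -> 0 <= h ->
  (1 - q) * expR (q * h) + q * expR (q * h - h) <= expR (h ^+ 2 / 8).
Proof.
move=> q01 h0.
pose f h : R := h ^+ 2 / 8 - q * h - ln (w q h).
have df (x : R) : is_derive x 1 f (x / 4 - q + q * expR (- x) / w q x).
  have w0 := w_gt0 x q01; have w0' : w q x != 0 by rewrite gt_eqF.
  have dw := is_derive_w q x; have dln := is_derive1_ln w0.
  have dl : is_derive x 1 (fun h => ln (w q h)) ((w q x)^-1 * - (q * expR (- x))).
    exact: (@is_derive1_comp R (@ln R) (w q)).
  apply: is_derive_eq; rewrite /GRing.scale/=.
  by move: (expR _) (w q x) w0' {w0 dw dln dl} => e W W0; field.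
have : f 0 <= f h.
  apply: (@ger0_derive1_ndecry R f 0 _ _ _ _ _ (lexx 0) h0).
  - by move=> x _; have [] := df x.
  - move=> x; rewrite in_itv/= andbT => x0; have [_ dfx] := df x.
    by rewrite derive1E dfx slope_ge0// ltW.
  - by apply: derivable_within_continuous => x _; have [] := df x.
rewrite {1}/f /w oppr0 expR0 mulr1 subrK ln1 expr0n/= mul0r mulr0 !subr0 /f.
move=> f0; have wE : q * h + ln (w q h) <= h ^+ 2 / 8 by lra.
apply: le_trans (_ : expR (q * h + ln (w q h)) <= _); last by rewrite ler_expR.
rewrite [leRHS]expRD lnK ?posrE ?w_gt0// /w expRD.
by move: (expR _) (expR _) => A B; lra.
Qed.

End two_point.

Lemma expR_chord {R : realType} (a b x : R) : a < b -> a <= x <= b ->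
  expR x <= (b - x) / (b - a) * expR a + (x - a) / (b - a) * expR b.
Proof.
move=> ab /andP[ax xb].
have ba : b - a != 0 by rewrite gt_eqF// subr_gt0.
have t0 : 0 <= (b - x) / (b - a) by rewrite divr_ge0// subr_ge0// ltW.
have t1 : (b - x) / (b - a) <= 1.
  by rewrite ler_pdivrMr ?subr_gt0// mul1r lerB.
have := convex_expR (Itv01 t0 t1) a b; rewrite !convRE/=.
have -> : (b - x) / (b - a) * a + (1 - (b - x) / (b - a)) * b = x by field.
move=> /le_trans; apply; rewrite lerD2l.
rewrite /unstable.onem.
by have -> : 1 - (b - x) / (b - a) = (x - a) / (b - a) by field.

Qed.

(** * Means of bounded measurable functions *)

Section bounded_measurable.
Context {d : measure_display} {T : measurableType d} {R : realType}.
Implicit Types (f g : T -> R) (P : probability T R).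

(** This class is integrable for every probability and stable under products, exponentials, sections
    and partial integration, so integrability never has to be tracked. The bound on Osc_2 places the
    recentred kernel in it. *)
Definition bounded_measurable f :=
  measurable_fun setT f /\ exists M, forall x, `|f x| <= M.

Lemma bounded_measurable_cst (c : R) : bounded_measurable (fun=> c).
Proof. by split; [exact: measurable_cst|exists `|c|]. Qed.

Lemma bounded_measurableD f g :
  bounded_measurable f -> bounded_measurable g ->
  bounded_measurable (fun x => f x + g x).
Proof.
move=> [mf [M fM]] [mg [M' gM']]; split; first exact: measurable_funD.
by exists (M + M') => x; rewrite (le_trans (ler_normD _ _))// lerD.
Qed.

Lemma bounded_measurableM f g :
  bounded_measurable f -> bounded_measurable g ->
  bounded_measurable (fun x => f x * g x).
Proof.
move=> [mf [M fM]] [mg [M' gM']]; split; first exact: measurable_funM.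
by exists (M * M') => x; rewrite normrM ler_pM.
Qed.

Lemma bounded_measurableZ (c : R) f :
  bounded_measurable f -> bounded_measurable (fun x => c * f x).
Proof. exact/bounded_measurableM/bounded_measurable_cst. Qed.

Lemma bounded_measurableB f g :
  bounded_measurable f -> bounded_measurable g ->
  bounded_measurable (fun x => f x - g x).
Proof.
move=> bf bg; have := bounded_measurableD bf (bounded_measurableZ (-1) bg).
by congr bounded_measurable; apply/funext => x; rewrite mulN1r.
Qed.

Lemma bounded_measurable_sum (I : Type) (s : seq I) (h : I -> T -> R) :
  (forall i, bounded_measurable (h i)) ->
  bounded_measurable (fun x => \sum_(i <- s) h i x).
Proof.
move=> bh; elim: s => [|i s IHs].
  under eq_fun do rewrite big_nil; exact: bounded_measurable_cst.
by under eq_fun do rewrite big_cons; exact: bounded_measurableD.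
Qed.

Lemma bounded_measurable_expR f :
  bounded_measurable f -> bounded_measurable (fun x => expR (f x)).
Proof.
move=> [mf [M fM]]; split; first exact: measurableT_comp.
exists (expR M) => x; rewrite ger0_norm ?expR_ge0// ler_expR.
by rewrite (le_trans (ler_norm _)).
Qed.

Lemma bounded_measurable_integrable P f :
  bounded_measurable f -> P.-integrable setT (EFin \o f).
Proof.
move=> [mf [M fM]]; apply: measurable_bounded_integrable => //.
  by rewrite [X in (X < _)%E]probability_setT ltry.
exists M; split; first by rewrite num_real.
by move=> y My x _; exact: le_trans (fM x) (ltW My).
Qed.

Section expectation.
Context (P : probability T R).

Lemma mean_cst (c : R) : \int[P]_x c = c.
Proof. by rewrite Rintegral_cst// [X in fine X]probability_setT mulr1. Qed.

Lemma meanD f g : bounded_measurable f -> bounded_measurable g ->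
  \int[P]_x (f x + g x) = \int[P]_x f x + \int[P]_x g x.
Proof. by move=> *; rewrite RintegralD//; exact: bounded_measurable_integrable. Qed.

Lemma meanB f g : bounded_measurable f -> bounded_measurable g ->
  \int[P]_x (f x - g x) = \int[P]_x f x - \int[P]_x g x.
Proof. by move=> *; rewrite RintegralB//; exact: bounded_measurable_integrable. Qed.

Lemma meanZ (c : R) f : bounded_measurable f ->
  \int[P]_x (c * f x) = c * \int[P]_x f x.
Proof. by move=> bf; rewrite RintegralZl//; exact: bounded_measurable_integrable. Qed.

Lemma le_mean f g : bounded_measurable f -> bounded_measurable g ->
  (forall x, f x <= g x) -> \int[P]_x f x <= \int[P]_x g x.
Proof. by move=> bf bg fg; apply: le_Rintegral => //; exact: bounded_measurable_integrable. Qed.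

Lemma mean_bound f (M : R) : bounded_measurable f ->
  (forall x, `|f x| <= M) -> `|\int[P]_x f x| <= M.
Proof.
move=> bf fM; rewrite ler_norml -[- M]mean_cst -[X in _ && (_ <= X)]mean_cst.
have h x : - M <= f x <= M by rewrite -ler_norml.
by rewrite !le_mean//; first [exact: bounded_measurable_cst | move=> x; have /andP[] := h x].
Qed.

Lemma mean_sum (I : Type) (s : seq I) (h : I -> T -> R) :
  (forall i, bounded_measurable (h i)) ->
  \int[P]_x (\sum_(i <- s) h i x) = \sum_(i <- s) \int[P]_x h i x.
Proof.
move=> bh; elim: s => [|i s IHs].
  under eq_Rintegral do rewrite big_nil.
  by rewrite mean_cst big_nil.
under eq_Rintegral do rewrite big_cons.
by rewrite big_cons meanD ?IHs//; exact: bounded_measurable_sum.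
Qed.

(** The values of [f] lie in [c - 2 r, c] with c = sup f. By convexity exp lies below its chord
    there, and the mean of the chord is the exponential moment of the centred law on the two
    endpoints. *)
Lemma hoeffding f (r : R) : bounded_measurable f -> 0 <= r ->
  (forall x y, f x - f y <= 2 * r) -> \int[P]_x f x = 0 ->
  \int[P]_x expR (f x) <= expR (r ^+ 2 / 2).
Proof.
move=> bf r0 fr f0.
have [_ [M fM]] := bf.
pose c := sup (range f).
have fub : has_ubound (range f).
  by exists M => _ [x _ <-]; rewrite (le_trans (ler_norm _)).
have fc x : f x <= c by apply: ub_le_sup => //; exists x.
have cf x : c - 2 * r <= f x.
  rewrite lerBlDr addrC; apply: ge_sup; first by exists (f x), x.
  by move=> _ [y _ <-]; have := fr y x; rewrite lerBlDr addrC.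
have c0 : 0 <= c.
  by rewrite -f0 -[leRHS]mean_cst; apply: le_mean => //; exact: bounded_measurable_cst.
have c2r : c - 2 * r <= 0.
  by rewrite -f0 -[leLHS]mean_cst; apply: le_mean => //; exact: bounded_measurable_cst.
(* For r = 0 the interval is a point and has no chord; [f] is then identically 0. *)
have [r00|rn0] := eqVneq r 0.
  have fE x : f x = 0 by have := cf x; have := fc x; move: c0 c2r; rewrite r00; lra.
  under eq_Rintegral do rewrite fE expR0.
  by rewrite mean_cst -expR0 ler_expR r00 expr0n/= mul0r.
have r_gt0 : 0 < r by rewrite lt_neqAle eq_sym rn0.
set a := c - 2 * r in cf c2r.
have ac : a < c by rewrite /a; lra.
have ca : c - a = 2 * r by rewrite /a; lra.
pose u := (expR c - expR a) / (c - a).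
pose v := (c * expR a - a * expR c) / (c - a).
have chord x : expR (f x) <= u * f x + v.
  have := @expR_chord R a c (f x) ac; rewrite cf fc => /(_ isT)/le_trans; apply.
  by rewrite /u /v le_eqVlt; apply/orP; left; apply/eqP; field; rewrite ca; lra.
apply: le_trans (_ : \int[P]_x (u * f x + v) <= _).
  apply: le_mean => //; first exact: bounded_measurable_expR.
  apply: bounded_measurableD; last exact: bounded_measurable_cst.
  exact: bounded_measurableZ.
rewrite meanD ?mean_cst; last 2 first.
- exact: bounded_measurableZ.
- exact: bounded_measurable_cst.
rewrite meanZ// f0.
(* The mass at the lower endpoint that makes the two-point law centred; the gap h = 2 r turns h^2/8
   into r^2/2. *)
pose q := c / (2 * r).
have q01 : 0 <= q <= 1.
  by rewrite /q divr_ge0 ?ler_pdivrMr ?mulr_gt0// ?mulr_ge0// mul1r -subr_le0.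
have := @two_point_expR R q (2 * r) q01 (mulr_ge0 (ler0n R 2) r0).
have -> : q * (2 * r) = c by rewrite /q; field.
have -> : (2 * r) ^+ 2 / 8 = r ^+ 2 / 2 by field.
rewrite -/a; apply: le_trans; rewrite le_eqVlt; apply/orP; left; apply/eqP.
rewrite mulr0 add0r /v /q ca; move: (expR c) (expR a) => C A.
by rewrite /a; field.
Qed.

End expectation.
End bounded_measurable.

(** * Product measures *)

Section product.
Context {d1 d2 : measure_display} {T1 : measurableType d1}
  {T2 : measurableType d2} {R : realType}.
Implicit Types (P : probability T1 R) (Q : probability T2 R).

Lemma bounded_measurable_comp (f : T2 -> R) (g : T1 -> T2) :
  measurable_fun setT g -> bounded_measurable f -> bounded_measurable (f \o g).
Proof.
move=> mg [mf [M fM]]; split; first exact: measurableT_comp.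
by exists M => x; exact: fM.
Qed.

Lemma mean_distribution P (X : {mfun T1 >-> T2}) (f : T2 -> R) :
  bounded_measurable f ->
  \int[distribution P X]_y f y = \int[P]_x f (X x).
Proof.
move=> bf; rewrite /Rintegral integral_distribution//.
  by apply/measurable_EFinP; case: bf.
apply: bounded_measurable_integrable.
by apply: bounded_measurable_comp => //; exact: measurable_funPT.
Qed.

Section fubini.
Context Q (K : T1 * T2 -> R) (bK : bounded_measurable K).

Lemma bounded_measurable_section (x : T1) :
  bounded_measurable (fun y => K (x, y)).
Proof.
split; last by have [_ [M KM]] := bK; exists M.
by apply: measurableT_comp; [case: bK|exact: measurable_pair1].
Qed.

Lemma bounded_measurable_mean : bounded_measurable (fun x => \int[Q]_y K (x, y)).
Proof.
split; last first.
  have [_ [M KM]] := bK; exists M => x; apply: mean_bound => //.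
  exact: bounded_measurable_section.
apply: measurableT_comp => //.
(* Measurability comes from integrability on a product space; a Dirac mass serves as first
   marginal. *)
apply: (@measurable_fubini_F _ _ T1 T2 R (dirac point) Q (EFin \o K)).
exact: bounded_measurable_integrable.
Qed.

Lemma mean_prod P :
  \int[(P \x Q)%E]_p K p = \int[P]_x \int[Q]_y K (x, y).
Proof.
rewrite /Rintegral -integral12_prod_meas1; last exact: bounded_measurable_integrable.
congr fine; apply: eq_integral => x _; rewrite fineK//.
have := bounded_measurable_integrable Q (bounded_measurable_section x).
exact: integrable_fin_num.
Qed.

End fubini.
End product.

Lemma mean_prod_power (d : measure_display) (T : measurableType d)
    (R : realType) (m : probability T R) (n : nat) (f : n.+1.-tuple T -> R) :
  bounded_measurable f ->
  \int[prod_power m n.+1]_x f x =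
  \int[m]_x \int[prod_power m n]_t f [tuple of x :: t].
Proof.
move=> bf; rewrite /= mean_distribution// mean_prod//.
apply: bounded_measurable_comp => //; exact: measurable_funPT.
Qed.

(** * Positive kernels as bilinear forms on lists of points *)

Section bilinear.
Context {T : Type} {R : realType}.
Variable V : T -> T -> R.
Implicit Types (a b l : seq T).

(** A list stands for the sum of its Dirac masses. If V(x, y) = <phi x, phi y>, this is the inner
    product of the two sums of phi; working with lists avoids constructing a Hilbert space. *)
Definition bilin a b := \sum_(x <- a) \sum_(y <- b) V x y.

(** For symmetric [V], the squared norm of the sum of phi over [a] minus that over [b]. *)
Definition sqdist a b := bilin a a - 2 * bilin a b + bilin b b.

(** Multiplication of the vector of [a] by the natural number [k]. *)
Definition repeat_seq (k : nat) a := flatten (nseq k a).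

Lemma bilin_catl a a' b : bilin (a ++ a') b = bilin a b + bilin a' b.
Proof. by rewrite /bilin big_cat. Qed.

Lemma bilin_repeat_seql k a b : bilin (repeat_seq k a) b = k%:R * bilin a b.
Proof.
elim: k => [|k IHk]; first by rewrite /bilin big_nil mul0r.
by rewrite [repeat_seq _ _]/= bilin_catl [X in _ + X]IHk -[k.+1%:R]natr1 mulrDl mul1r addrC.
Qed.

Lemma size_repeat_seq k a : size (repeat_seq k a) = (k * size a)%N.
Proof. by rewrite size_flatten /shape map_nseq sumn_nseq mulnC. Qed.

Hypothesis V_sym : forall x y, V x y = V y x.

Lemma bilinC a b : bilin a b = bilin b a.
Proof.
rewrite /bilin exchange_big/=; apply: eq_bigr => y _.
by apply: eq_bigr => x _; rewrite V_sym.
Qed.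

Lemma bilin_catr a b b' : bilin a (b ++ b') = bilin a b + bilin a b'.
Proof. by rewrite bilinC bilin_catl !(bilinC a). Qed.

Lemma bilin_repeat_seqr k a b : bilin a (repeat_seq k b) = k%:R * bilin a b.
Proof. by rewrite bilinC bilin_repeat_seql (bilinC a). Qed.

Lemma sqdist_consr a b x :
  sqdist a (x :: b) =
  sqdist a b - 2 * (bilin a [:: x] - bilin b [:: x]) + bilin [:: x] [:: x].
Proof.
rewrite /sqdist -cat1s !bilin_catl !bilin_catr (bilinC [:: x] b).
ring.
Qed.

Lemma bilin1 x y : bilin [:: x] [:: y] = V x y.
Proof. by rewrite /bilin !big_seq1. Qed.

Lemma sqdist_repeat_seq k a b :
  sqdist (repeat_seq k a) (repeat_seq k b) = k%:R ^+ 2 * sqdist a b.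
Proof.
rewrite /sqdist !bilin_repeat_seql !bilin_repeat_seqr; ring.
Qed.

End bilinear.

(** * Positivity for unequal masses, and Cauchy-Schwarz *)

Section positive_definite.
Context {d : measure_display} {T : measurableType d} {R : realType}.
Context (m : probability T R) (V : T -> T -> R).
Implicit Types (a b l : seq T).
Local Notation B := (bilin V).

Hypothesis V_bounded : bounded_measurable (fun p : T * T => V p.1 p.2).
Hypothesis V_sym : forall x y, V x y = V y x.
Hypothesis V_mean : forall x, \int[m]_y V x y = 0.
Hypothesis V_diag : forall x, V x x <= 4.
Hypothesis V_diam : forall x y, V x x - 2 * V x y + V y y <= 4.
Hypothesis V_pos : forall a b, size a = size b -> 0 <= sqdist V a b.

Let V_section x : bounded_measurable (V x).
Proof. exact: (bounded_measurable_section V_bounded x). Qed.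

Lemma bounded_measurable_bilin1 a : bounded_measurable (fun x => B a [:: x]).
Proof.
by apply: bounded_measurable_sum => y; under eq_fun do rewrite big_seq1.
Qed.

Let mean_bilin1 a : \int[m]_x B a [:: x] = 0.
Proof.
rewrite /bilin; under eq_Rintegral do under eq_bigr do rewrite big_seq1.
by rewrite mean_sum// big1.
Qed.

Let bounded_measurable_diag : bounded_measurable (fun x => V x x).
Proof.
apply: (bounded_measurable_comp (f := fun p => V p.1 p.2) (g := fun x => (x, x))) => //.
exact: measurable_fun_pair.
Qed.

(* Completing [b] by independent samples of [m] to the length of [a] increases
   the squared distance by at most 4 per sample on average. In this way positivity,
   known on atomic measures only, extends to an [m] without second moment. *)
Let sqdist_lower_bound k a b :
  size a = (k + size b)%N -> - (4 * k%:R) <= sqdist V a b.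
Proof.
elim: k b => [|k IHk] b ab; first by rewrite mulr0 oppr0 V_pos.
have IH x : - (4 * k%:R) <= sqdist V a (x :: b).
  by apply: IHk; rewrite ab addSnnS.
have bab := bounded_measurableB (bounded_measurable_bilin1 a)
  (bounded_measurable_bilin1 b).
have bab2 := bounded_measurableZ 2 bab.
have bc c := @bounded_measurable_cst _ T R c.
have : - (4 * k%:R) <= \int[m]_x sqdist V a (x :: b).
  rewrite -[leLHS](mean_cst m); apply: le_mean => //.
  under eq_fun do rewrite sqdist_consr// bilin1.
  exact/bounded_measurableD/bounded_measurable_diag/bounded_measurableB.
under eq_Rintegral do rewrite sqdist_consr// bilin1.
rewrite meanD ?meanB ?meanZ ?mean_cst//; last exact: bounded_measurableB.
rewrite meanB ?mean_bilin1; try exact: bounded_measurable_bilin1.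
have : \int[m]_x V x x <= 4.
  by rewrite -[leRHS](mean_cst m); apply: le_mean.
by rewrite -[k.+1%:R]natr1; lra.
Qed.

(** Repeating both lists [k] times multiplies the squared distance by k^2, but the number of missing
    points, and with it the error in [sqdist_lower_bound], only by [k]. Letting [k] grow removes the
    error. *)
Lemma sqdist_ge0 a b : (size b <= size a)%N -> 0 <= sqdist V a b.
Proof.
move=> ba; rewrite -oppr_le0.
apply: (@archimedean_le0 _ _ (4 * (size a - size b)%:R)) => k.
case: k => [|k]; first by rewrite mul0r mulr_ge0.
have := @sqdist_lower_bound (k.+1 * (size a - size b)) (repeat_seq k.+1 a) (repeat_seq k.+1 b).
rewrite !size_repeat_seq -mulnDr subnK// => /(_ erefl).
rewrite sqdist_repeat_seq// natrM => h.
rewrite -(ler_pM2l (_ : 0 < k.+1%:R))//.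
by move: h; rewrite expr2; lra.
Qed.

(** As [V] is centred, comparing [a] with the empty list amounts to comparing it with size(a) times
    [m]. *)
Lemma bilin_ge0 a : 0 <= B a a.
Proof.
have := @sqdist_ge0 a [::]; rewrite /sqdist => /(_ isT).
by rewrite bilinC// /bilin !big_nil mulr0 subr0 addr0.
Qed.

(* Points come with integer multiplicities, so the discriminant is read off
   integers [p], [q] with [q / p] close to the minimiser [beta / 4]. *)
Lemma bilin_cauchy_schwarz a x y :
  B a [:: x] - B a [:: y] <= 2 * Num.sqrt (B a a).
Proof.
have [b0|b0] := leP (B a [:: x] - B a [:: y]) 0.
  by apply: le_trans b0 _; rewrite mulr_ge0 ?sqrtr_ge0.
set beta := _ - _ in b0 *.
(* Expansion of |p a + q y - q x|^2 >= 0, where |x - y|^2 <= 4 by [V_diam]. The copies of [y] on the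
   left make the lengths comparable, as [sqdist_ge0] requires. *)
have quad (p q : nat) :
    0 <= p%:R ^+ 2 * B a a - 2 * (p%:R * q%:R) * beta + 4 * q%:R ^+ 2.
  have := @sqdist_ge0 (repeat_seq p a ++ repeat_seq q [:: y]) (repeat_seq q [:: x]).
  rewrite size_cat !size_repeat_seq leq_addl => /(_ isT).
  rewrite /sqdist !bilin_catl !bilin_catr// !bilin_repeat_seql !bilin_repeat_seqr//.
  rewrite (bilinC V_sym [:: y] a) !bilin1 (V_sym y x) => h.
  apply: le_trans h _; rewrite -subr_ge0.
  set r := (X in 0 <= X).
  have -> : r = q%:R ^+ 2 * (4 - (V x x - 2 * V x y + V y y)).
    rewrite /r /beta; ring.
  by rewrite mulr_ge0 ?sqr_ge0// subr_ge0.
have sq : beta ^+ 2 / 4 <= B a a.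
  rewrite -subr_le0; apply: (@archimedean_le0 _ _ 4) => -[|p].
    by rewrite mul0r.
  have z0 : 0 <= p.+1%:R * beta / 4 by rewrite !mulr_ge0// ltW.
  have [q qz zq] : exists2 q : nat, q%:R <= p.+1%:R * beta / 4 &
      p.+1%:R * beta / 4 < q%:R + 1.
    have /andP[qz zq] := truncn_itv z0.
    by exists (Num.truncn (p.+1%:R * beta / 4)); rewrite ?natr1.
  have := quad p.+1 q.
  have P1 : 1 <= p.+1%:R :> R by rewrite ler1n.
  move: P1 {quad} z0 qz zq.
  move: (p.+1%:R) (q%:R) => P Q P1 z0 qz zq h.
  (* The form in [quad] equals P^2 (B a a - beta^2/4) + 4 (P beta/4 - Q)^2. Rounding P beta/4 down
     to Q therefore costs at most 4, uniformly in P. *)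
  have e2 : 4 * (P * beta / 4 - Q) ^+ 2 <= 4 by nra.
  have {}h : P ^+ 2 * (beta ^+ 2 / 4 - B a a) <= 4.
    apply: le_trans e2; rewrite -subr_ge0.
    rewrite [X in 0 <= X](_ : _ = P ^+ 2 * B a a - 2 * (P * Q) * beta + 4 * Q ^+ 2)//.
    by field.
  have [e0|e0] := leP (beta ^+ 2 / 4 - B a a) 0.
  by apply: (@le_trans _ _ 0) => //; rewrite mulr_ge0_le0//; lra.
  apply: le_trans h; rewrite ler_pM2r// expr2; nra.
rewrite -(ger0_norm (ltW b0)) -sqrtr_sqr -[2]ger0_norm// -(sqrtr_sqr 2).
rewrite -sqrtrM ?sqr_ge0// ler_wsqrtr//; lra.
Qed.

End positive_definite.

(** * Exponential moment *)

Section exponential_moment.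
Context {d : measure_display} {T : measurableType d} {R : realType}.
Context (m : probability T R) (V : T -> T -> R).
Implicit Types (a b l : seq T).
Local Notation B := (bilin V).

Hypothesis V_bounded : bounded_measurable (fun p : T * T => V p.1 p.2).

Lemma bounded_measurable_bilin_tuple n l :
  bounded_measurable (fun s : n.-tuple T => B (s ++ l) (s ++ l)).
Proof.
have Vt (f g : n.-tuple T -> T) : measurable_fun setT f -> measurable_fun setT g ->
    bounded_measurable (fun s => V (f s) (g s)).
  move=> mf mg; apply: (bounded_measurable_comp (g := fun s => (f s, g s)) _ V_bounded).
  exact: measurable_fun_pair.
have tnthE (F : T -> R) (s : n.-tuple T) :
    \sum_(x <- s ++ l) F x = \sum_(i < n) F (tnth s i) + \sum_(x <- l) F x.
  by rewrite big_cat big_tuple.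
under eq_fun => s.
  rewrite /bilin tnthE; under eq_bigr do rewrite tnthE.
  under [X in _ + X]eq_bigr do rewrite tnthE.
  over.
have mt i : measurable_fun setT (fun s : n.-tuple T => tnth s i) by exact: measurable_tnth.
have mc (c : T) : measurable_fun setT (fun _ : n.-tuple T => c) by exact: measurable_cst.
apply: bounded_measurableD; apply: bounded_measurable_sum => i;
  by apply: bounded_measurableD; apply: bounded_measurable_sum => j; apply: Vt.
Qed.

Hypothesis V_sym : forall x y, V x y = V y x.
Hypothesis V_mean : forall x, \int[m]_y V x y = 0.
Hypothesis V_diag : forall x, V x x <= 4.
Hypothesis V_diam : forall x y, V x x - 2 * V x y + V y y <= 4.
Hypothesis V_pos : forall a b, size a = size b -> 0 <= sqdist V a b.

(** Hoeffding's lemma with r = sqrt (B l l) / u: the exponent has mean 0 by [V_mean], and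
    [bilin_cauchy_schwarz] bounds its oscillation by 2 r. *)
Let mean_expR_bilin1 l (u : R) : 0 < u ->
  \int[m]_x expR (B l [:: x] / u) <= expR (B l l / (2 * u ^+ 2)).
Proof.
move=> u0; have A0 := bilin_ge0 V_bounded V_sym V_mean V_diag V_pos l.
have bl := bounded_measurable_bilin1 V_bounded l.
have -> : B l l / (2 * u ^+ 2) = (Num.sqrt (B l l) / u) ^+ 2 / 2.
  by rewrite expr_div_n sqr_sqrtr//; field; rewrite gt_eqF.
apply: hoeffding.
- under eq_fun do rewrite mulrC; exact: bounded_measurableZ.
- by rewrite divr_ge0 ?sqrtr_ge0// ltW.
- move=> x y; rewrite -mulrBl mulrA ler_pM2r ?invr_gt0//.
  exact: (bilin_cauchy_schwarz V_bounded V_sym V_mean V_diag V_diam V_pos).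
- under eq_Rintegral do rewrite mulrC.
  rewrite meanZ// /bilin mean_sum; last first.
    by move=> y; under eq_fun do rewrite big_seq1; exact: (bounded_measurable_section V_bounded).
  by rewrite big1 ?mulr0// => y _; under eq_Rintegral do rewrite big_seq1.
Qed.

(** Here [l] holds the points that are already fixed. In the induction the first sample joins [l],
    the others are integrated out by the induction hypothesis, and the first one last, by
    [mean_expR_bilin1]. *)
Lemma exponential_moment n (t : R) l : n%:R < t ->
  \int[prod_power m n]_s expR (B (s ++ l) (s ++ l) / (2 * t)) <=
  expR (B l l / (2 * (t - n%:R)) + \sum_(k < n) 2 / (t - k%:R)).
Proof.
elim: n l => [|n IHn] l nt.
  rewrite (_ : (fun s : 0.-tuple T => _) = fun=> expR (B l l / (2 * t))).
    by rewrite mean_cst subr0 big_ord0 addr0.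
  by apply/funext => s; rewrite (tuple0 s).
have n0 : 0 <= n%:R :> R := ler0n _ _.
have nt' : n%:R + 1 < t by move: nt; rewrite -[n.+1%:R]natr1.
have bE k l' : bounded_measurable
    (fun s : k.-tuple T => expR (B (s ++ l') (s ++ l') / (2 * t))).
  apply: bounded_measurable_expR; under eq_fun do rewrite mulrC.
  exact/bounded_measurableZ/bounded_measurable_bilin_tuple.
rewrite mean_prod_power//.
have cE x (s : n.-tuple T) : B ([tuple of x :: s] ++ l) ([tuple of x :: s] ++ l) =
    B (s ++ x :: l) (s ++ x :: l).
  rewrite /= -cat1s -[x :: l]cat1s !bilin_catl !bilin_catr//.
  by rewrite (bilinC V_sym [:: x] s); ring.
set S := \sum_(k < n) 2 / (t - k%:R) : R.
have [u tnE] : exists u, t - n%:R = u by exists (t - n%:R).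
have uE : t - n.+1%:R = u - 1 by rewrite -[n.+1%:R]natr1 -tnE; ring.
have u1 : 1 < u by rewrite -tnE; lra.
have u0 : 0 < u by lra.
have un0 : u != 0 by rewrite gt_eqF.
have bl := bounded_measurable_bilin1 V_bounded l.
have bg : bounded_measurable (fun x => expR (B l [:: x] / u)).
  apply: bounded_measurable_expR; under eq_fun do rewrite mulrC.
  exact: bounded_measurableZ.
(* With u = t - n, expand |l + x|^2 / (2 u): the diagonal term V(x, x) / (2 u) is at most 2/u, and
   the cross term B l [x] / u is left for Hoeffding. *)
apply: (@le_trans _ _
    (\int[m]_x (expR (B l l / (2 * u) + 2 / u + S) * expR (B l [:: x] / u)))).
  apply: le_mean.
  - apply: (@bounded_measurable_mean _ _ _ _ _ (prod_power m n)
      (fun p => expR (B ([tuple of p.1 :: p.2] ++ l) ([tuple of p.1 :: p.2] ++ l) / (2 * t)))).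
    apply: (bounded_measurable_comp (f := fun s : n.+1.-tuple T =>
      expR (B (s ++ l) (s ++ l) / (2 * t))) (g := @cons_pair _ T n)) => //.
  - exact: bounded_measurableZ.
  move=> x; under eq_Rintegral do rewrite cE.
  apply: le_trans (IHn _ _) _; first lra.
  rewrite tnE -expRD ler_expR -/S -(cat1s x l).
  rewrite !bilin_catl !bilin_catr// bilin1 (bilinC V_sym [:: x] l).
  rewrite -subr_ge0 [X in 0 <= X](_ : _ = (4 - V x x) / (2 * u)); last by field.
  by rewrite divr_ge0 ?subr_ge0// mulr_ge0// ltW.
rewrite meanZ//.
apply: le_trans (ler_wpM2l (expR_ge0 _) (mean_expR_bilin1 l u0)) _.
rewrite -expRD ler_expR big_ord_recr/= -/S uE.
have A0 := bilin_ge0 V_bounded V_sym V_mean V_diag V_pos l.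
have u10 : 0 < u - 1 by lra.
(* Hoeffding adds B l l / (2 u^2) to B l l / (2 u); passing from u to u - 1 absorbs it, since 1/u +
   1/u^2 <= 1/(u - 1). *)
rewrite tnE -subr_ge0 [X in 0 <= X](_ : _ = B l l / (2 * u ^+ 2 * (u - 1))).
  by rewrite divr_ge0// ?mulr_ge0 ?sqr_ge0// ltW.
by field; rewrite un0 gt_eqF.
Qed.

End exponential_moment.

(** * Entropy duality *)

Section entropy_duality.
Context {d : measure_display} {T : measurableType d} {R : realType}.
Implicit Types (nu mu : probability T R).
Local Open Scope ereal_scope.

(** Integrability is asked of the lower function only, because [h] will be a log-density whose
    integral may be +oo. The proof compares positive and negative parts. *)
Lemma le_integral_integrablel nu (g h : T -> \bar R) :
  nu.-integrable setT g -> measurable_fun setT h -> (forall x, g x <= h x) ->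
  \int[nu]_x g x <= \int[nu]_x h x.
Proof.
move=> ig mh gh; rewrite integralE [leRHS]integralE.
have mg := measurable_int _ ig.
have gp := @funepos_le _ _ setT g h (fun x _ => gh x).
have gn := @funeneg_le _ _ setT g h (fun x _ => gh x).
apply: leeB.
- apply: ge0_le_integral => //; [exact: measurable_funepos..|].
  by move=> x _; apply: gp; rewrite inE.
- apply: ge0_le_integral => //; [exact: measurable_funeneg..|].
  by move=> x _; apply: gn; rewrite inE.
Qed.

Let measurable_lne_fin (f : T -> \bar R) :
  measurable_fun setT f -> (forall x, f x \is a fin_num) ->
  measurable_fun setT (fun x => lne (f x)).
Proof.
move=> mf ff; have mf1 : measurable_fun setT (fun x => fine (f x)).
  exact: measurableT_comp.
rewrite (_ : (fun x => lne (f x)) = (fun x =>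
    if (fine (f x) <= 0)%R then -oo else (ln (fine (f x)))%:E)); last first.
  by apply/funext => x; rewrite -{1}(fineK (ff x)).
apply: measurable_fun_ifT => //.
- exact: measurable_fun_ler.
- by apply/measurable_EFinP; apply: measurableT_comp => //; exact: measurable_ln.
Qed.

(** With f the density of [nu], the inequality 1 + t <= exp t gives F - c + 1 - exp (F - c) / f <=
    ln f. Integrate against [nu]: the mean of exp (F - c) / f is at most that of exp (F - c) under
    [mu], hence at most 1. *)
Lemma donsker_varadhan nu mu (F : T -> R) (c : R) :
  bounded_measurable F -> (\int[mu]_x expR (F x) <= expR c)%R ->
  (\int[nu]_x F x)%:E <= rel_entropy nu mu + c%:E.
Proof.
move=> bF Fc; rewrite /rel_entropy; case: asboolP => [numu|_]; last first.
  by rewrite addye// leey.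
set rn := Radon_Nikodym _ _.
have nu_rn x : rn x \is a fin_num by exact: Radon_Nikodym_fin_num.
(* A version of the density that is nonnegative and finite everywhere; it agrees [nu]-almost
   everywhere with the derivative [rn] used in the entropy. *)
pose f := Radon_Nikodym_SigmaFinite.f nu mu.
have f0 : forall x, 0 <= f x by exact: Radon_Nikodym_SigmaFinite.f_ge0.
have ff : forall x, f x \is a fin_num by exact: Radon_Nikodym_SigmaFinite.f_fin_num.
have mf : measurable_fun setT f.
  exact: measurable_int (Radon_Nikodym_SigmaFinite.f_integrable numu).
have mrn : measurable_fun setT rn.
  by have /integrableP[] := @Radon_Nikodym_integrable _ T R (charge_of_finite_measure nu) mu numu.
have frn : ae_eq nu setT f rn.
  apply: (null_dominates_ae_eq _ numu) => //.
  exact: ae_eq_Radon_Nikodym_SigmaFinite.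
pose E x := expR (F x - c).
have bE : bounded_measurable E.
  exact/bounded_measurable_expR/bounded_measurableB/bounded_measurable_cst.
have mf1 : measurable_fun setT (fun x => fine (f x)) by exact: measurableT_comp.
have mlf : measurable_fun setT (fun x => ln (fine (f x))).
  by apply: measurableT_comp => //; exact: measurable_ln.
(* This is 1/f where f > 0, and 1 where f = 0 because ln 0 = 0; in all cases f r <= 1. *)
pose r x := expR (- ln (fine (f x))).
have mr : measurable_fun setT r.
  by apply: measurableT_comp => //; apply: measurableT_comp.
have Er0 x : 0 <= (E x * r x)%:E by rewrite lee_fin mulr_ge0 ?expR_ge0.
have mEr : measurable_fun setT (fun x => (E x * r x)%:E).
  by apply/measurable_EFinP/measurable_funM => //; case: bE.
have Er1 : \int[nu]_x (E x * r x)%:E <= 1.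
  rewrite -(Radon_Nikodym_SigmaFinite.change_of_variables numu)//.
  apply: (@le_trans _ _ (\int[mu]_x (E x)%:E)).
    apply: ge0_le_integral => //.
    - by move=> x _; exact: mule_ge0.
    - exact: emeasurable_funM.
    - by apply/measurable_EFinP; case: bE.
    move=> x _; rewrite -/(f x) -(fineK (ff x)) -EFinM lee_fin -mulrA.
    rewrite ler_piMr ?expR_ge0// /r.
    have : (0 <= fine (f x))%R by exact: fine_ge0.
    rewrite le_eqVlt => /predU1P[<-|fx0]; first by rewrite mulr0.
    by rewrite expRN lnK// mulVf// gt_eqF.
  have iE := bounded_measurable_integrable mu bE.
  rewrite -[leLHS]fineK; last exact: integrable_fin_num iE.
  rewrite lee_fin -/(Rintegral mu setT E) /E.
  under eq_Rintegral do rewrite expRD mulrC.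
  rewrite meanZ; last exact: bounded_measurable_expR.
  by rewrite expRN ler_pdivrMl ?expR_gt0// mulr1.
have iEr : nu.-integrable setT (fun x => (E x * r x)%:E).
  apply/integrableP; split => //.
  under eq_integral do rewrite gee0_abs//.
  by rewrite (le_lt_trans Er1) ?ltry.
have bFc : bounded_measurable (fun x => F x - c + 1)%R.
  apply: bounded_measurableD; last exact: bounded_measurable_cst.
  exact/bounded_measurableB/bounded_measurable_cst.
have iFc := bounded_measurable_integrable nu bFc.
have mN : measurable [set x | f x = 0].
  rewrite -[X in measurable X]setTI.
  by apply: (mf measurableT [set 0]); exact: emeasurable_set1.
have nz : nu [set x | f x = 0] = 0.
  rewrite (Radon_Nikodym_SigmaFinite.f_integral numu)// integral0_eq//.
have lneE : ae_eq nu setT (fun x => (ln (fine (f x)))%:E) (fun x => lne (rn x)).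
  have : {ae nu, forall x, f x != 0}.
    exists [set x | f x = 0]; split => //.
    by move=> x /=; apply: contra_notP => /eqP.
  apply: filterS2 frn => x /(_ I) <- fx0 _.
  rewrite -{2}(fineK (ff x)) lne_EFin// lt_neqAle fine_ge0// andbT.
  by rewrite -eqe (fineK (ff x)) eq_sym.
have <- : \int[nu]_x (ln (fine (f x)))%:E = \int[nu]_x lne (rn x).
  apply: ae_eq_integral => //; first exact/measurable_EFinP.
  exact: measurable_lne_fin.
apply: (@le_trans _ _ (\int[nu]_x ((F x - c + 1) - E x * r x)%:E + c%:E)); last first.
  rewrite leeD2r//; apply: le_integral_integrablel.
  - by under eq_fun do rewrite EFinB; exact: integrableB.
  - exact/measurable_EFinP.
  - (* [1 + t <= expR t] at [t = F x - c - ln (f x)]; where [f x = 0] the junk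
       value [ln 0 = 0] is harmless, this set being [nu]-null. *)
    move=> x; rewrite lee_fin /E /r -expRD.
    by have := expR_ge1Dx (F x - c - ln (fine (f x))); lra.
rewrite integralB_EFin//.
rewrite -(fineK (integrable_fin_num _ iFc))//.
rewrite -(fineK (integrable_fin_num _ iEr))//.
rewrite -EFinB -EFinD lee_fin -!/(Rintegral _ _ _).
rewrite meanD ?meanB ?mean_cst//; try exact: bounded_measurable_cst; last first.
  exact/bounded_measurableB/bounded_measurable_cst.
have : (Rintegral nu setT (fun x => E x * r x) <= 1)%R.
  by rewrite -lee_fin fineK//; exact: integrable_fin_num iEr.
lra.
Qed.

End entropy_duality.

(** * Empirical measures and centred kernels *)

Section empirical_probability.
Context {d : measure_display} {T : measurableType d} {R : realType}.
Context (n : nat) (s : n.+1.-tuple T).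

(** The length is a successor: with no point the total mass would be 0. *)
Let empirical_setT : empirical R s setT = 1%E.
Proof.
rewrite /empirical; under eq_bigr do rewrite diracT.
rewrite sumEFin big_const_ord iter_addr_0 -EFinM; congr (_%:E).
by rewrite mulVf// pnatr_eq0.
Qed.

HB.instance Definition _ :=
  Measure_isProbability.Build _ _ _ (empirical R s) empirical_setT.

Lemma ge0_integral_empirical (f : T -> \bar R) :
  measurable_fun setT f -> (forall x, (0 <= f x)%E) ->
  (\int[empirical R s]_x f x =
   (n.+1%:R^-1)%:E * \sum_(i < n.+1) f (tnth s i))%E.
Proof.
move=> mf f0.
rewrite (@eq_measure_integral _ _ _ _
  (mscale (n.+1%:R^-1)%:nng (msum (fun i => \d_(nth point s i)) n.+1))); last first.
  move=> A mA _; rewrite /= /empirical /mscale /msum/=; congr (_ * _)%E.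
  by apply: eq_bigr => i _; rewrite (tnth_nth point).
rewrite ge0_integral_mscale// ge0_integral_measure_sum//; congr (_ * _)%E.
apply: eq_bigr => i _; rewrite integral_dirac// diracT mul1e.
by rewrite (tnth_nth point).
Qed.

Lemma mean_empirical (f : T -> R) : bounded_measurable f ->
  \int[empirical R s]_x f x = n.+1%:R^-1 * \sum_(x <- s) f x.
Proof.
move=> bf; have [mf [M fM]] := bf.
(* The shift by the bound [M] reduces to a nonnegative integrand. *)
have -> : \int[empirical R s]_x f x = \int[empirical R s]_x (f x + M) - M.
  rewrite meanD ?mean_cst ?addrK//; exact: bounded_measurable_cst.
rewrite {1}/Rintegral ge0_integral_empirical; last 2 first.
- by apply/measurable_EFinP/measurable_funD.
- by move=> x; rewrite lee_fin -lerBlDr sub0r; have := fM x; rewrite ler_norml => /andP[].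
rewrite sumEFin -EFinM/= big_tuple big_split/= sumr_const card_ord.
by rewrite mulrDr -[M *+ _]mulr_natl mulKf ?pnatr_eq0// addrK.
Qed.

End empirical_probability.

Section fubini_swap.
Context {d1 d2 : measure_display} {T1 : measurableType d1}
  {T2 : measurableType d2} {R : realType}.
Context (P : probability T1 R) (Q : probability T2 R).
Context (K : T1 * T2 -> R) (bK : bounded_measurable K).

Lemma mean_prod_swap : \int[(P \x Q)%E]_p K p = \int[Q]_y \int[P]_x K (x, y).
Proof.
rewrite /Rintegral -integral21_prod_meas1; last exact: bounded_measurable_integrable.
congr fine; apply: eq_integral => y _; rewrite fineK//.
have : bounded_measurable (fun x => K (x, y)).
  apply: (bounded_measurable_comp (g := fun x => (x, y)) _ bK).
  exact: measurable_pair2.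
by move=> /(bounded_measurable_integrable P); exact: integrable_fin_num.
Qed.

End fubini_swap.

(** * Recentring the kernel at a base point *)

Section kernel.
Context {d : measure_display} {T : measurableType d} {R : realType}.
Context (U : T * T -> R) (mU : measurable_fun setT U) (o : T).
Local Notation K := (recenter o U).

Let measurable_Uo : measurable_fun setT (fun x => U (x, o)).
Proof. by apply: measurableT_comp mU _; exact: measurable_pair2. Qed.

Let measurable_oU : measurable_fun setT (fun y => U (o, y)).
Proof. by apply: measurableT_comp mU _; exact: measurable_pair1. Qed.

Lemma measurable_recenter : measurable_fun setT K.
Proof.
apply: measurable_funD; last exact: measurable_cst.
apply: measurable_funB; last exact: (measurableT_comp measurable_oU measurable_snd).
apply: measurable_funB => //.
exact: (measurableT_comp measurable_Uo measurable_fst).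
Qed.

Let Rintegral_prod_dirac x y : \int[(\d_x \x \d_y)%E]_p U p = U (x, y).
Proof.
rewrite /Rintegral (@eq_measure_integral _ _ _ _ (\d_(x, y))).
  by rewrite integral_dirac ?diracT ?mul1e//; exact/measurable_EFinP.
move=> A mA _; apply: product_measure_unique => // B C mB mC.
rewrite /= /dirac !indicE -EFinM -natrM mulnb; congr ((_ : bool)%:R%:E).
by rewrite in_setX.
Qed.

Definition quad_diff x y z w := U (x, z) - U (x, w) - U (y, z) + U (y, w).

Hypothesis U_osc2 : (osc2 U <= 4%:E)%E.

Lemma quad_diff_le x y z w : quad_diff x y z w <= 4.
Proof.
rewrite -lee_fin; apply: le_trans U_osc2; apply: ereal_sup_ubound.
by exists x, y, z, w; rewrite /pair_diff !Rintegral_prod_dirac.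
Qed.

(** Both K(x, y) and its opposite are values of [quad_diff], at (x, o, y, o) and (o, x, y, o), so
    the one-sided bound on Osc_2 controls the absolute value. *)
Lemma bounded_measurable_recenter : bounded_measurable K.
Proof.
split; first exact: measurable_recenter.
exists 4 => -[x y]; have := quad_diff_le x o y o; have := quad_diff_le o x y o.
by rewrite /quad_diff /recenter/= ler_norml => *; apply/andP; split; lra.
Qed.

(** The correction terms depend on at most one variable and cancel against measures of mass zero.
    [Q] is a class of measures for which [U] is integrable; having the Dirac mass at [o] in it makes
    these terms integrable too. *)
Lemma pair_diff_recenter (Q : probability T R -> Prop) (nu nu' : probability T R) :
  (forall eta eta', Q eta -> Q eta' -> (eta \x eta')%E.-integrable setT (EFin \o U)) ->
  Q (\d_o) -> Q nu -> Q nu' ->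
  pair_diff K nu nu' nu nu' = pair_diff U nu nu' nu nu'.
Proof.
move=> intU Qo Qnu Qnu'.
have intUo (eta : probability T R) : Q eta ->
    eta.-integrable setT (EFin \o (fun x => U (x, o))).
  move=> Qe; have := integrable_fubini_F (intU _ _ Qe Qo).
  apply: eq_integrable => // x _.
  rewrite /= /fubini_F integral_dirac ?diracT ?mul1e//.
  by apply/measurable_EFinP; apply: measurableT_comp mU _; exact: measurable_pair1.
have intoU (eta : probability T R) : Q eta ->
    eta.-integrable setT (EFin \o (fun y => U (o, y))).
  (* Sections are integrable for almost every first coordinate under the Dirac mass at [o]; a null
     set of that measure cannot contain [o]. *)
  move=> Qe; have [N [mN N0 sN]] := ae_integrable1 (intU _ _ Qo Qe).
  apply: contrapT => nP; have No : N o by exact: sN.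
  by move: N0; rewrite /= diracE mem_set// => /eqP; rewrite onee_eq0.
have int1 (eta eta' : probability T R) : Q eta -> Q eta' ->
    (eta \x eta')%E.-integrable setT (EFin \o (fun p => U (p.1, o))).
  move=> Qe Qe'; apply/integrable12ltyP.
    by apply/measurable_EFinP; apply: (measurableT_comp measurable_Uo measurable_fst).
  have /integrableP[_] := intUo _ Qe; apply: le_lt_trans.
  rewrite le_eqVlt; apply/orP; left; apply/eqP; apply: eq_integral => x _.
  by rewrite /= integral_cst// [X in (_ * X)%E]probability_setT mule1.
have int2 (eta eta' : probability T R) : Q eta -> Q eta' ->
    (eta \x eta')%E.-integrable setT (EFin \o (fun p => U (o, p.2))).
  move=> Qe Qe'; apply/integrable21ltyP.
    by apply/measurable_EFinP; apply: (measurableT_comp measurable_oU measurable_snd).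
  have /integrableP[_] := intoU _ Qe'; apply: le_lt_trans.
  rewrite le_eqVlt; apply/orP; left; apply/eqP; apply: eq_integral => x _.
  by rewrite /= integral_cst// [X in (_ * X)%E]probability_setT mule1.
have mean1 (eta eta' : probability T R) : Q eta -> Q eta' ->
    \int[(eta \x eta')%E]_p U (p.1, o) = \int[eta]_x U (x, o).
  move=> Qe Qe'; rewrite /Rintegral -integral12_prod_meas1; last exact: int1.
  congr fine; apply: eq_integral => x _.
  by rewrite /fubini_F/= integral_cst// [X in (_ * X)%E]probability_setT mule1.
have mean2 (eta eta' : probability T R) : Q eta -> Q eta' ->
    \int[(eta \x eta')%E]_p U (o, p.2) = \int[eta']_y U (o, y).
  move=> Qe Qe'; rewrite /Rintegral -integral21_prod_meas1; last exact: int2.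
  congr fine; apply: eq_integral => x _.
  by rewrite /fubini_G/= integral_cst// [X in (_ * X)%E]probability_setT mule1.
have meanK (eta eta' : probability T R) : Q eta -> Q eta' ->
    \int[(eta \x eta')%E]_p K p = \int[(eta \x eta')%E]_p U p
      - \int[eta]_x U (x, o) - \int[eta']_y U (o, y) + U (o, o).
  move=> Qe Qe'; have iU := intU _ _ Qe Qe'.
  have i1 := int1 _ _ Qe Qe'; have i2 := int2 _ _ Qe Qe'.
  have i3 : (eta \x eta')%E.-integrable setT
      (EFin \o (fun p => U p - U (p.1, o))).
    by under [_ \o _]eq_fun do rewrite /= EFinB; exact: integrableB.
  have i4 : (eta \x eta')%E.-integrable setT
      (EFin \o (fun p => U p - U (p.1, o) - U (o, p.2))).
    by under [_ \o _]eq_fun do rewrite /= EFinB; exact: integrableB.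
  have i5 : (eta \x eta')%E.-integrable setT (EFin \o (fun=> U (o, o))).
    exact/bounded_measurable_integrable/bounded_measurable_cst.
  by rewrite /recenter RintegralD// RintegralB// RintegralB// mean1 ?mean2 ?mean_cst.
rewrite /pair_diff !meanK//; ring.
Qed.

End kernel.

(** * Centring by m and symmetrisation *)

Section centering.
Context {d : measure_display} {T : measurableType d} {R : realType}.
Context (m : probability T R) (K : T * T -> R) (bK : bounded_measurable K).

Let rowmean x := \int[m]_y K (x, y).
Let colmean y := \int[m]_x K (x, y).
Let c := \int[m]_x rowmean x.

(** The pairing of [K] with the product of delta_x - m and delta_y - m. *)
Definition centered x y := K (x, y) - rowmean x - colmean y + c.

(** [U] need not be symmetric, whereas the bilinear form must be; symmetrising leaves the quadratic
    form unchanged. *)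
Definition sym_centered x y := (centered x y + centered y x) / 2.

Let b_row : bounded_measurable rowmean.
Proof. exact: bounded_measurable_mean. Qed.

Let b_swap : bounded_measurable (fun p => K (p.2, p.1)).
Proof.
by apply: (bounded_measurable_comp (g := fun p => (p.2, p.1)) _ bK); exact: measurable_fun_pair.
Qed.

Let b_col : bounded_measurable colmean.
Proof. exact: (bounded_measurable_mean m b_swap). Qed.

Let b_sec1 x : bounded_measurable (fun y => K (x, y)).
Proof. exact: bounded_measurable_section. Qed.

Let b_sec2 y : bounded_measurable (fun x => K (x, y)).
Proof. exact: (bounded_measurable_section b_swap). Qed.

Let b_cst r : bounded_measurable (fun _ : T => r : R).
Proof. exact: bounded_measurable_cst. Qed.

Let mean_colmean : \int[m]_y colmean y = c.
Proof. by rewrite -mean_prod_swap// mean_prod. Qed.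

Let b_centered : bounded_measurable (fun p => centered p.1 p.2).
Proof.
have b1 : bounded_measurable (fun p : T * T => rowmean p.1).
  by apply: bounded_measurable_comp b_row; exact: measurable_fst.
have b2 : bounded_measurable (fun p : T * T => colmean p.2).
  by apply: bounded_measurable_comp b_col; exact: measurable_snd.
apply: bounded_measurableD; last exact: bounded_measurable_cst.
apply: bounded_measurableB b2; apply: bounded_measurableB b1.
by rewrite (_ : (fun p => _) = K)//; apply/funext => -[].
Qed.

Lemma bounded_measurable_sym_centered :
  bounded_measurable (fun p => sym_centered p.1 p.2).
Proof.
have b2 : bounded_measurable (fun p : T * T => centered p.2 p.1).
  by apply: (bounded_measurable_comp (g := fun p => (p.2, p.1)) _ b_centered);
    exact: measurable_fun_pair.
have := bounded_measurableZ 2^-1 (bounded_measurableD b_centered b2).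
by congr bounded_measurable; apply/funext => p; rewrite mulrC.
Qed.

Lemma sym_centeredC x y : sym_centered x y = sym_centered y x.
Proof. by rewrite /sym_centered addrC. Qed.

Lemma mean_sym_centered x : \int[m]_y sym_centered x y = 0.
Proof.
have cE y : sym_centered x y = 2^-1 * ((K (x, y) - colmean y) + (K (y, x) - rowmean y)
   + (c + c - rowmean x - colmean x)).
  by rewrite /sym_centered /centered; ring.
under eq_Rintegral do rewrite cE.
have b1 : bounded_measurable (fun y => K (x, y) - colmean y) by exact: bounded_measurableB.
have b2 : bounded_measurable (fun y => K (y, x) - rowmean y) by exact: bounded_measurableB.
have b12 := bounded_measurableD b1 b2.
rewrite meanZ; last exact: bounded_measurableD.
rewrite meanD// meanD// meanB// meanB// mean_cst mean_colmean -/(rowmean x) -/(colmean x) -/c.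
ring.
Qed.

Lemma bilin_sym_centered (l : seq T) :
  bilin sym_centered l l = bilin centered l l.
Proof.
have -> : bilin sym_centered l l =
    2^-1 * (bilin centered l l + \sum_(x <- l) \sum_(y <- l) centered y x).
  rewrite /bilin -big_split/= mulr_sumr; apply: eq_bigr => x _.
  by rewrite -big_split/= mulr_sumr; apply: eq_bigr => y _; rewrite mulrC.
by rewrite exchange_big/= -/(bilin centered l l); field.
Qed.

Section diameter.
Hypothesis K_diff : forall x y z w, K (x, z) - K (x, w) - K (y, z) + K (y, w) <= 4.

(** The diagonal value is the average over independent x' and y of law [m] of K(x, x) - K(x, y) -
    K(x', x) + K(x', y), each of which is at most 4. *)
Lemma sym_centered_diag x : sym_centered x x <= 4.
Proof.
have -> : sym_centered x x = centered x x by rewrite /sym_centered; field.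
have h x' : K (x, x) - rowmean x - K (x', x) + rowmean x' <= 4.
  have : \int[m]_y (K (x, x) - K (x, y) - K (x', x) + K (x', y)) <= 4.
    rewrite -[leRHS](mean_cst m); apply: le_mean => //.
    exact/bounded_measurableD/b_sec1/bounded_measurableB/b_cst/bounded_measurableB.
  rewrite meanD//; last exact/bounded_measurableB/b_cst/bounded_measurableB.
  by rewrite meanB ?meanB ?mean_cst//; exact: bounded_measurableB.
have : \int[m]_x' (K (x, x) - rowmean x - K (x', x) + rowmean x') <= 4.
  rewrite -[leRHS](mean_cst m); apply: le_mean => //.
  exact/bounded_measurableD/b_row/bounded_measurableB.
by rewrite meanD ?meanB ?mean_cst//; exact: bounded_measurableB.
Qed.

Lemma sym_centered_diam x y :
  sym_centered x x - 2 * sym_centered x y + sym_centered y y <= 4.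
Proof.
rewrite [leLHS](_ : _ = K (x, x) - K (x, y) - K (y, x) + K (y, y)) ?K_diff//.
by rewrite /sym_centered /centered; field.
Qed.

End diameter.

Lemma bilin_centered (a b : seq T) :
  bilin centered a b = bilin (fun x y => K (x, y)) a b
    - (size b)%:R * \sum_(x <- a) \int[m]_y K (x, y)
    - (size a)%:R * \sum_(y <- b) \int[m]_x K (x, y)
    + (size a)%:R * (size b)%:R * \int[m]_x \int[m]_y K (x, y).
Proof.
have sumc (l : seq T) (z : R) : \sum_(x <- l) z = (size l)%:R * z.
  by rewrite big_const_seq count_predT iter_addr_0 mulr_natl.
rewrite /bilin; under eq_bigr do rewrite big_split/= !sumrB !sumc.
rewrite big_split/= !sumrB !sumc -mulr_sumr.
by rewrite mulrA.
Qed.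

(** Equal lengths make the difference of the two sums of Dirac masses have mass zero, so every
    centring term cancels and [m] disappears. *)
Lemma sqdist_sym_centered (a b : seq T) : size a = size b ->
  sqdist sym_centered a b = 
  bilin (fun x y => K (x, y)) a a - bilin (fun x y => K (x, y)) a b
  - bilin (fun x y => K (x, y)) b a + bilin (fun x y => K (x, y)) b b.
Proof.
move=> ab.
have -> : sqdist sym_centered a b =
    bilin centered a a - bilin centered a b - bilin centered b a + bilin centered b b.
  rewrite /sqdist !bilin_sym_centered.
  suff -> : 2 * bilin sym_centered a b = bilin centered a b + bilin centered b a by ring.
  rewrite [bilin centered b a]exchange_big/= -big_split/= mulr_sumr.
  apply: eq_bigr => x _; rewrite -big_split/= mulr_sumr; apply: eq_bigr => y _.
  by rewrite /sym_centered mulrC divfK.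
rewrite !bilin_centered ab; ring.
Qed.

End centering.

(** * Second moments of atomic measures *)

Lemma measurable_sqnorm (R : realType) (d : nat) :
  measurable_fun setT (fun x : base_space R Euclidean d => (sqnorm x)%:E).
Proof.
apply/(measurable_EFinP setT (@sqnorm R d)); apply: measurable_sum => i.
have : measurable_fun setT (fun x : base_space R Euclidean d => (tnth x i : R)).
  exact: measurable_tnth.
exact: measurable_funX.
Qed.

Lemma sqnorm_ge0 (R : realType) (d : nat) (x : base_space R Euclidean d) : 0 <= sqnorm x.
Proof. by apply: sumr_ge0 => i _; exact: sqr_ge0. Qed.

Lemma finite_second_moment_dirac (R : realType) (k : space_kind) (d : nat)
  (o : base_space R k d) : finite_second_moment (\d_o : probability _ R).
Proof.
case: k o => //= o; rewrite integral_dirac ?diracT ?mul1e ?ltry//.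
exact: measurable_sqnorm.
Qed.

Lemma finite_second_moment_empirical (R : realType) (k : space_kind) (d n : nat)
  (s : n.+1.-tuple (base_space R k d)) :
  finite_second_moment (empirical R s : probability _ R).
Proof.
case: k s => //= s; rewrite ge0_integral_empirical.
- by rewrite sumEFin -EFinM ltry.
- exact: measurable_sqnorm.
- by move=> x; rewrite lee_fin sqnorm_ge0.
Qed.

(** * Pairings of empirical measures as bilinear forms *)

Section pairing_bilinear.
Context {d : measure_display} {T : measurableType d} {R : realType}.
Context (K : T * T -> R) (bK : bounded_measurable K).

Lemma pair_diff_mean (nu nu' : probability T R) :
  pair_diff K nu nu' nu nu' =
  \int[nu]_x \int[nu]_y K (x, y) - \int[nu]_x \int[nu']_y K (x, y)
  - \int[nu']_x \int[nu]_y K (x, y) + \int[nu']_x \int[nu']_y K (x, y).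
Proof. by rewrite /pair_diff !mean_prod. Qed.

Lemma mean_empirical2 n (s t : n.+1.-tuple T) :
  \int[empirical R s]_x \int[empirical R t]_y K (x, y) =
  n.+1%:R ^- 2 * bilin (fun x y => K (x, y)) s t.
Proof.
rewrite mean_empirical; last exact: bounded_measurable_mean.
have E x : \int[empirical R t]_y K (x, y) = n.+1%:R^-1 * \sum_(y <- t) K (x, y).
  by rewrite mean_empirical//; exact: bounded_measurable_section.
under eq_bigr do rewrite E.
by rewrite -mulr_sumr mulrA -invfM.
Qed.

Lemma pair_diff_empirical n (s t : n.+1.-tuple T) (m : probability T R) :
  pair_diff K (empirical R s) (empirical R t) (empirical R s) (empirical R t) =
  n.+1%:R ^- 2 * sqdist (sym_centered m K) s t.
Proof.
rewrite pair_diff_mean !mean_empirical2 sqdist_sym_centered ?size_tuple//.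
ring.
Qed.

Lemma bilin_centered_empirical n (s : n.+1.-tuple T) (m : probability T R) :
  pair_diff K (empirical R s) m (empirical R s) m =
  n.+1%:R ^- 2 * bilin (sym_centered m K) s s.
Proof.
have E x : \int[empirical R s]_y K (x, y) = n.+1%:R^-1 * \sum_(y <- s) K (x, y).
  by rewrite mean_empirical//; exact: bounded_measurable_section.
have bK2 y : bounded_measurable (fun x => K (x, y)).
  by apply: (bounded_measurable_comp (g := fun x => (x, y)) _ bK); exact: measurable_pair2.
have cross : \int[m]_x \int[empirical R s]_y K (x, y) =
    n.+1%:R^-1 * \sum_(y <- s) \int[m]_x K (x, y).
  under eq_Rintegral do rewrite E.
  by rewrite meanZ ?mean_sum//; exact: bounded_measurable_sum.
rewrite pair_diff_mean mean_empirical2 cross mean_empirical; last exact: bounded_measurable_mean.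
rewrite bilin_sym_centered bilin_centered// size_tuple.
have : n.+1%:R != 0 :> R by rewrite pnatr_eq0.
by move: (n.+1%:R : R) => N N0; field.
Qed.

End pairing_bilinear.

(** * From the exponential moment to the entropy bound *)

Unset Implicit Arguments.
Set Strict Implicit.
Local Close Scope classical_set_scope.

Theorem corollary3 (R : realType) (k : space_kind) (d : nat)
    (U : base_space R k d * base_space R k d -> R)
    (U_measurable : measurable_fun setT U)
    (U_growth : quadratic_growth U)
    (U_positive : positive_kernel U)
    (U_osc2 : (osc2 U <= 4%:E)%E)
    (N : nat) (N_ge1 : (1 <= N)%N)
    (delta : R) (delta01 : 0 < delta < 1)
    (o : base_space R k d)
    (m : probability (base_space R k d) R)
    (nuN : probability (N.-tuple (base_space R k d)) R) :
  (N%:R%:E * 'E_nuN[fun x => sq_pairing o U (empirical R x) m]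
   <= (2 / (1 - delta))%:E * rel_entropy nuN (prod_power m N)
      + (4 * (1 + (1 - delta) / (2 * delta)))%:E)%E.
Proof.
case: N N_ge1 nuN => // n _ nuN.
have [d0 d1] := andP delta01.
pose K := recenter o U.
have bK : bounded_measurable K by exact: bounded_measurable_recenter.
pose V := sym_centered m K.
have intU : forall eta eta', finite_second_moment eta -> finite_second_moment eta' ->
    (eta \x eta')%E.-integrable setT (EFin \o U).
  by move=> eta eta' qe qe'; have [] := U_positive _ _ qe qe'.
have KU eta eta' : finite_second_moment eta -> finite_second_moment eta' ->
    pair_diff K eta eta' eta eta' = pair_diff U eta eta' eta eta'.
  by apply: pair_diff_recenter => //; exact: finite_second_moment_dirac.
(* Two nonempty lists of equal length are the same multiple of two empirical measures, to which
   positivity of [U] applies; empty lists are treated apart. *)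
have V_pos a b : size a = size b -> 0 <= sqdist V a b.
  case: a b => [|x a] [|y b] //= => [_|[ab]].
    by rewrite /sqdist /bilin !big_nil mulr0 subrr addr0.
  have sb : size (y :: b) == (size a).+1 by rewrite /= ab.
  have := finite_second_moment_empirical (in_tuple (x :: a)).
  have := finite_second_moment_empirical (Tuple sb).
  move=> qb qa; have [_] := U_positive _ _ qa qb.
  rewrite -KU// (pair_diff_empirical bK _ _ m) pmulr_rge0//.
  by rewrite invr_gt0 exprn_gt0.
(* Both branches of [sq_pairing] agree: with a second moment for [m], recentring does not change the
   pairing. *)
have sqE (x : n.+1.-tuple (base_space R k d)) :
    sq_pairing o U (empirical R x) m = n.+1%:R ^- 2 * bilin V x x.
  rewrite -bilin_centered_empirical// /sq_pairing; case: asboolP => // qm.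
  by rewrite -KU//; exact: finite_second_moment_empirical.
(* Chosen so that [F] below is (1 - delta) / (2 N) times the quadratic form, while t - N = N delta /
   (1 - delta) stays positive. *)
pose t := n.+1%:R / (1 - delta).
have N0 : 0 < n.+1%:R :> R by rewrite ltr0Sn.
have t_gt : n.+1%:R < t.
  by rewrite /t ltr_pdivlMr ?subr_gt0// gtr_pMr//; lra.
have bV := bounded_measurable_sym_centered m bK.
pose F (x : n.+1.-tuple (base_space R k d)) := bilin V x x / (2 * t).
have bB : bounded_measurable (fun x : n.+1.-tuple (base_space R k d) => bilin V x x).
  have := bounded_measurable_bilin_tuple bV n.+1 [::].
  by under eq_fun do rewrite cats0.
have bF : bounded_measurable F.
  by under [F]eq_fun do rewrite mulrC; exact: bounded_measurableZ.
have Fexp : \int[prod_power m n.+1]_x expR (F x) <= expR (delta^-1 - delta).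
  have K_diff x y z w : K (x, z) - K (x, w) - K (y, z) + K (y, w) <= 4.
    have := quad_diff_le U_measurable U_osc2 x y z w.
    by rewrite /quad_diff /K /recenter/=; lra.
  have := exponential_moment bV (sym_centeredC m K) (mean_sym_centered m bK)
    (sym_centered_diag m bK K_diff) (sym_centered_diam m K_diff) V_pos [::] t_gt.
  under eq_Rintegral do rewrite cats0.
  move/le_trans; apply; rewrite ler_expR /bilin big_nil mul0r add0r.
  apply: le_trans (sum_inv_le t_gt) _; rewrite le_eqVlt; apply/orP; left; apply/eqP.
  have dn0 : delta != 0 by rewrite gt_eqF.
  have d1n0 : 1 - delta != 0 by rewrite gt_eqF// subr_gt0.
  have Nn0 : n.+1%:R != 0 :> R by rewrite gt_eqF.
  have -> : t - n.+1%:R = n.+1%:R * delta / (1 - delta) by rewrite /t; field.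
  rewrite /t; move: (n.+1%:R : R) Nn0 => N Nn0.
  by field; rewrite dn0 d1n0.
have := donsker_varadhan nuN bF Fexp.
rewrite unlock; set H := rel_entropy _ _ => dv.
under eq_integral do rewrite sqE.
have -> : (n.+1%:R%:E * \int[nuN]_w (n.+1%:R ^- 2 * bilin V w w)%:E =
    (2 / (1 - delta))%:E * (\int[nuN]_x F x)%:E)%E.
  have iB := bounded_measurable_integrable nuN (bounded_measurableZ (n.+1%:R ^- 2) bB).
  rewrite -[X in (_ * X = _)%E](fineK (integrable_fin_num _ iB))// -!EFinM; congr _%:E.
  rewrite -/(Rintegral _ _ _) meanZ//.
  have -> : \int[nuN]_x F x = (2 * t)^-1 * \int[nuN]_x bilin V x x.
    by rewrite -meanZ//; apply: eq_Rintegral => x _; rewrite mulrC.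
  move: N0; rewrite /t; move: (n.+1%:R : R) => N N0.
  by field; rewrite !gt_eqF//=; lra.
apply: le_trans (lee_wpmul2l _ dv) _.
  by rewrite lee_fin divr_ge0// subr_ge0 ltW.
(* The entropy may be +oo, but the other summand is finite, so the product distributes. The
   constants match: 2 / (1 - delta) times 1/delta - delta is 2 + 2/delta. *)
rewrite muleDr//; last exact: fin_num_adde_defl.
rewrite leeD2l// -EFinM lee_fin le_eqVlt; apply/orP; left; apply/eqP.
by field; rewrite !gt_eqF//=; lra.
Qed.
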